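(* Let $w$ be a word with $|w|=n$, $\mathrm{alph}(w)=\Sigma$ and $\Sigma=\{1,2,\ldots,\sigma\}$ (with $\sigma\le n$), and let $k$ be an integer with $k\le \iota(w)\le n/\sigma$. The minimal number of letter deletions needed to obtain from $w$ a word of universality index $k$ (with respect to $\Sigma$) can be computed in $O(nk)$ time.
   Context: Computational model: unit-cost word RAM with memory words of $\log n$ bits for inputs of size $n$; the input word is over an integer alphabet $\{1,\ldots,\sigma\}$ with $\sigma\le n$ and contains at least two distinct letters. For a word $w$, $\mathrm{alph}(w)$ is the set of letters occurring in $w$. A word $v=v_1\cdots v_\ell$ is a subsequence of $w$ if $w=x_1v_1x_2v_2\cdots x_\ell v_\ell x_{\ell+1}$ for some words $x_i$. A word $u$ is $k$-universal with respect to $\Sigma$ if every word of length $k$ over $\Sigma$ is a subsequence of $u$; the universality index of $u$ (with respect to $\Sigma$) is the largest $k$ such that $u$ is $k$-universal, and $\iota(w)$ denotes the universality index of $w$ with respect to $\mathrm{alph}(w)$. A deletion removes one letter from the word.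
   Formalization: The integer k is taken to be non-negative, the time bound is O(n·max(1,k)), since O(nk) would allow no steps at all for k = 0, and memory words have log n + O(1) bits so that the input and linear-size arrays can be addressed. *)

(* Defs.v *)
From mathcomp Require Import all_boot.

Set Implicit Arguments.
Unset Strict Implicit.
Unset Printing Implicit Defensive.

Definition alph (w : seq nat) : seq nat := undup w.

Definition universal (S : seq nat) (k : nat) (u : seq nat) : Prop :=
  forall v : seq nat, size v = k -> {subset v <= S} -> subseq v u.

Definition universality_index (S u : seq nat) (k : nat) : Prop :=
  universal S k u /\ (forall m : nat, universal S m u -> m <= k).

Inductive deletions : nat -> seq nat -> seq nat -> Prop :=
| Deletions0 u : deletions 0 u u
| DeletionsS m x a y u :
    deletions m (x ++ y) u -> deletions m.+1 (x ++ a :: y) u.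

Definition min_deletions (S w : seq nat) (k m : nat) : Prop :=
  (exists2 u : seq nat, deletions m w u & universality_index S u k) /\
  (forall (m' : nat) (u : seq nat),
     deletions m' w u -> universality_index S u k -> m <= m').

(* Unit-cost word RAM with [b]-bit words. Register names and jump targets are
   literals of the program text, so a program uses finitely many registers;
   memory is addressed indirectly through registers. *)

Inductive binop :=
  Add | Sub | Mul | Div | Mod | And | Or | Xor | Shl | Shr | Eq | Lt.

Inductive instr :=
| Const (r c : nat)            (* r := c *)
| Op (o : binop) (r s t : nat) (* r := s o t *)
| Read (r s : nat)             (* r := memory[s] *)
| Write (r s : nat)            (* memory[r] := s *)
| Jump (l : nat)
| JumpIf (r l : nat)           (* jump to l if r is nonzero *)
| Halt.

Definition program := seq instr.

Record config := Config { pc : nat; reg : nat -> nat; mem : nat -> nat }.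

Definition upd (f : nat -> nat) (i x : nat) : nat -> nat :=
  fun j => if j == i then x else f j.

(* For operands [x, y < 2 ^ b]; the result is reduced modulo [2 ^ b] in
   [step], so [Sub] is subtraction modulo [2 ^ b]. *)
Definition eval_op (b : nat) (o : binop) (x y : nat) : nat :=
  match o with
  | Add => x + y
  | Sub => x + (2 ^ b - y)
  | Mul => x * y
  | Div => x %/ y
  | Mod => x %% y
  | And => Nat.land x y
  | Or  => Nat.lor x y
  | Xor => Nat.lxor x y
  | Shl => x * 2 ^ y
  | Shr => x %/ 2 ^ y
  | Eq  => x == y
  | Lt  => x < y
  end.

(* Running off the end of the program halts. *)
Definition fetch (P : program) (c : config) : instr := nth Halt P (pc c).

Definition step (b : nat) (P : program) (c : config) : config :=
  let: Config p r m := c in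
  match fetch P c with
  | Const i x    => Config p.+1 (upd r i (x %% 2 ^ b)) m
  | Op o i s t   => Config p.+1 (upd r i (eval_op b o (r s) (r t) %% 2 ^ b)) m
  | Read i s     => Config p.+1 (upd r i (m (r s))) m
  | Write i s    => Config p.+1 r (upd m (r i) (r s))
  | Jump l       => Config l r m
  | JumpIf i l   => Config (if r i != 0 then l else p.+1) r m
  | Halt         => c
  end.

Definition halted (P : program) (c : config) : Prop :=
  if fetch P c is Halt then True else False.

(* The input occupies the memory cells 0, 1, ...; all else starts at 0. *)
Definition init (input : seq nat) : config :=
  Config 0 (fun _ => 0) (nth 0 input).

(* The output is the content of register 0 at halting time. *)
Definition computes_within
    (b : nat) (P : program) (input : seq nat) (time output : nat) : Prop :=
  exists t : nat, [/\ t <= time,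
    halted P (iter t (step b P) (init input)) &
    reg (iter t (step b P) (init input)) 0 = output].

(* [(trunc_log 2 n).+1] is the length of the binary representation of [n > 0];
   the constant [e] leaves room to address a constant number of arrays of
   length [n] in the flat memory. *)
Definition word_length (e n : nat) : nat := (trunc_log 2 n).+1 + e.

(* Main.v *)
(** Deleting one letter lowers the universality index by at most one, so the
    task is to find the fewest deletions after which some word of length [k + 1]
    is no longer a subsequence. Let [M t p] be the least number of deletions in
    the prefix of length [p] after which some word of length [t] is not a
    subsequence ([M 0 p] is infinite), and [G t p a] the same for words of length
    [t + 1] ending with [a]. Reading the letter [a] at position [p] changes
    [G t p a] to [min (G t p a + 1) (M t p)] and no other value, and [M (t + 1) p]
    is the minimum of [G t p a] over [a]. Since [G t p a <= M t p], the update is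
    an increment by at most one, so the minimum is maintained in constant time by
    counting, for every [c], the letters whose value exceeds [c]; thus each of
    the [k + 1] rounds takes linear time. *)

Require Import Defs.
From mathcomp Require Import all_boot zify.

Set Implicit Arguments.
Unset Strict Implicit.
Unset Printing Implicit Defensive.

(** * Deletions, subsequences and the loss of universality *)

Lemma deletions_cons m a w u :
  deletions m w u -> deletions m (a :: w) (a :: u).
Proof.
elim=> {m w u} [u|m x b y u _ IH]; first exact: Deletions0.
exact: (@DeletionsS m (a :: x) b y).
Qed.

Lemma subseq_deletions u w :
  subseq u w -> deletions (size w - size u) w u.
Proof.
elim: w u => [|a w IH] [|b u] //=; first by move=> _; exact: Deletions0.
  move=> _; have := IH [::] (sub0seq _); rewrite !subn0.
  exact: (@DeletionsS _ [::] a w).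
case: eqP => [->|_] sub_uw; first by rewrite subSS; exact/deletions_cons/IH.
have:= size_subseq sub_uw => /= le_uw; rewrite subSn //.
exact: (@DeletionsS _ [::] a w _ (IH (b :: u) sub_uw)).
Qed.

Lemma deletions_subseq m w u :
  deletions m w u -> subseq u w /\ size u + m = size w.
Proof.
elim=> {m w u} [u|m x a y u _ [sub_u sz_u]]; first by rewrite addn0.
split; last by rewrite addnS sz_u !size_cat addnS.
apply: subseq_trans sub_u _.
by rewrite cat_subseq // subseq_cons.
Qed.

Lemma deletions_last m w u :
  deletions m.+1 w u ->
  exists x a y, u = x ++ y /\ deletions m w (x ++ a :: y).
Proof.
elim: m w => [|m IH] w del.
  inversion del as [|? x a y ? del0]; subst; inversion del0; subst.
  by exists x, a, y; split=> //; exact: Deletions0.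
inversion del as [|? x a y ? del1]; subst.
have [x' [b [y' [-> del']]]] := IH _ del1.
by exists x', b, y'; split=> //; exact: DeletionsS.
Qed.

(* The letter [b] is the first one of [v] that a leftmost embedding of [v] does
   not place inside [x]; doubling it forces the rest of [v] to the right of
   the deleted letter. *)
Lemma subseq_delete_double (x : seq nat) a y v :
  v != [::] ->
  exists v1 b v2, v = v1 ++ b :: v2 /\
    (subseq (v1 ++ b :: b :: v2) (x ++ a :: y) -> subseq v (x ++ y)).
Proof.
elim: x v => [|c x IH] [|d v] // _.
  exists [::], d, v; split=> //=; case: eqP => // _.
  exact: subseq_trans (subseq_cons _ _).
have [eq_dc|ne_dc] := eqVneq d c; last first.
  have [v1 [b [v2 [def_v sub_v]]]] := IH (d :: v) isT.
  exists v1, b, v2; split=> //=; rewrite (negbTE ne_dc).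
  case: v1 def_v sub_v => [|e v1] /= [<- _]; rewrite (negbTE ne_dc); exact.
case: v => [|e v]; first by exists [::], d, [::]; rewrite /= eq_dc eqxx sub0seq.
have [v1 [b [v2 [-> sub_v]]]] := IH (e :: v) isT.
by exists (d :: v1), b, v2; rewrite /= eq_dc eqxx.
Qed.

(** Doubling a suitable letter gives a word of length [k.+1] over the same letters; its embedding
    around [a] leaves one of the original word that avoids [a]. *)
Lemma universal_delete S k x a y :
  universal S k.+1 (x ++ a :: y) -> universal S k (x ++ y).
Proof.
move=> univ v sz_v sub_v; have [->|v_n0] := eqVneq v [::]; first exact: sub0seq.
have [v1 [b [v2 [def_v]]]] := subseq_delete_double x a y v_n0; apply.
apply: univ; first by rewrite -sz_v def_v !size_cat /= !addnS.
move=> z z_in; apply: sub_v; move: z_in; rewrite def_v !mem_cat !inE.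
by case: (z == b).
Qed.

Lemma universal_leq S a j k u :
  a \in S -> j <= k -> universal S k u -> universal S j u.
Proof.
move=> aS le_jk univ v sz_v sub_v.
apply: subseq_trans (prefix_subseq v (nseq (k - j) a)) _; apply: univ.
  by rewrite size_cat size_nseq sz_v subnKC.
by move=> z; rewrite mem_cat mem_nseq => /orP [/sub_v|/andP [_ /eqP ->]].
Qed.

(** Reduces exact index [k] to making some word of length [k.+1] disappear: fewer than [m] deletions
    keep the word [k.+1]-universal, and the [m]-th deletion costs at most one level. *)
Lemma min_deletionsI S a w k m u v :
  a \in S -> universal S k w ->
  deletions m w u -> size v = k.+1 -> {subset v <= S} -> ~~ subseq v u ->
  (forall u' v', subseq u' w -> size v' = k.+1 -> {subset v' <= S} ->
     ~~ subseq v' u' -> m <= size w - size u') ->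
  min_deletions S w k m.
Proof.
move=> aS univ_w del_u sz_v sub_v not_vu low.
have univ_u m' : m' < m -> forall u', deletions m' w u' -> universal S k.+1 u'.
  move=> lt_m' u' /deletions_subseq [sub_u' sz_u'] v' sz_v' sub_v'.
  apply: contraTT lt_m' => /(low u' v' sub_u' sz_v' sub_v').
  by rewrite -sz_u' addKn leqNgt.
split=> [|m' u' del_u' [_ max_k]].
  exists u => //; split; last first.
    move=> j univ_j; rewrite leqNgt; apply: contra not_vu => lt_kj.
    exact: (universal_leq aS lt_kj univ_j).
  (* With no deletion [u] is [w]; otherwise the word just before the last deletion is still
     [k.+1]-universal. *)
  case: m del_u univ_u {low} => [|m] del_u univ_u; first by inversion del_u; subst.
  have [x [b [y [-> /univ_u univ_x]]]] := deletions_last del_u.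
  exact/universal_delete/univ_x.
rewrite leqNgt; apply/negP => /univ_u /(_ _ del_u') /max_k; by rewrite ltnn.
Qed.

(** * The recurrence and its correctness *)

(* With [D p] the bound of the previous round: the least number of deletions in
   [take p w] after which some [v a] with [|v| = t] is not a subsequence. *)
Fixpoint letter_cost (w : seq nat) (D : nat -> nat) (p a : nat) : nat :=
  if p is p'.+1 then
    let c := letter_cost w D p' a in
    if (nth 0 w p' == a) && (c.+1 != D p') then c.+1 else c
  else 0.

(** The seed [f 1] replaces an infinite value; 1 is in the range as soon as [sigma] is positive. *)
Definition letter_min (sigma : nat) (f : nat -> nat) : nat :=
  foldr minn (f 1) (map f (iota 1 sigma)).

(* One more than the least number of deletions in [take p w] after which some
   word of length [t] is not a subsequence; the value 0 at [t = 0] stands for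
   infinity, which agrees with the zero-initialised memory. *)
Fixpoint bound (sigma : nat) (w : seq nat) (t p : nat) : nat :=
  if t is t'.+1 then
    (letter_min sigma (letter_cost w (bound sigma w t') p)).+1
  else 0.

Lemma letter_min_le sigma f a :
  a \in iota 1 sigma -> letter_min sigma f <= f a.
Proof.
rewrite /letter_min; elim: (iota _ _) => //= b s IH.
by rewrite inE geq_min => /predU1P [->|/IH ->]; rewrite ?leqnn ?orbT.
Qed.

Lemma letter_min_mem sigma f :
  0 < sigma -> exists2 a, a \in iota 1 sigma & f a = letter_min sigma f.
Proof.
move=> sigma_gt0.
(* The seed is kept as a separate alternative so that the induction can run over an arbitrary
   list. *)
suff: letter_min sigma f = f 1 \/
    exists2 a, a \in iota 1 sigma & f a = letter_min sigma f.
  by case=> // ->; exists 1; rewrite // mem_iota; lia.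
rewrite /letter_min; elim: (iota _ _) => [|b s IH] /=; first by left.
have [le|lt] := leqP (f b) (foldr minn (f 1) (map f s)).
  by right; exists b; rewrite ?mem_head.
case: IH => [->|[a a_s <-]]; first by left.
by right; exists a; rewrite // inE a_s orbT.
Qed.

Lemma letter_min_unique sigma f m :
  (exists2 a, a \in iota 1 sigma & f a = m) ->
  (forall a, a \in iota 1 sigma -> m <= f a) -> letter_min sigma f = m.
Proof.
move=> [a a_s fa] min_m.
have sigma_gt0 : 0 < sigma by move: a_s; rewrite mem_iota; lia.
have [b b_s fb] := letter_min_mem f sigma_gt0.
apply/eqP; rewrite eqn_leq; apply/andP; split; first by rewrite -fa letter_min_le.
by rewrite -fb min_m.
Qed.

Lemma letter_cost_le w D p a : letter_cost w D p a <= p.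
Proof. by elim: p => //= p IH; case: ifP => _; [exact: IH | exact: leqW]. Qed.

Lemma letter_cost_leS w D p a : letter_cost w D p a <= letter_cost w D p.+1 a.
Proof. by rewrite /=; case: ifP. Qed.

(** This is [G <= M] with the shift by one. It makes the rule that increments unless [c.+1] equals
    the bound compute the minimum of [c + 1] and [M]. The bound grows with [p], and an increment
    never reaches it. *)
Lemma letter_cost_bound sigma w t p a : 0 < sigma ->
  letter_cost w (bound sigma w t.+1) p a < bound sigma w t.+1 p.
Proof.
move=> sigma_gt0; elim: p => [|p IH]; first by [].
have leM : bound sigma w t.+1 p <= bound sigma w t.+1 p.+1.
  have [b b_s min_b] := letter_min_mem (letter_cost w (bound sigma w t) p.+1) sigma_gt0.
  rewrite [leqRHS]/= -/(letter_cost w (bound sigma w t) p.+1) -min_b ltnS.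
  exact: leq_trans (letter_min_le _ b_s) (letter_cost_leS _ _ _ _).
apply: leq_trans leM; rewrite [letter_cost _ _ p.+1 a]/=.
by case: ifP => // /andP [_ ne]; rewrite ltn_neqAle ne.
Qed.

(** Greedy matching from the right, obtained by reversal, because prefixes grow at their end. *)
Lemma subseq_rcons2 (T : eqType) (u v : seq T) a b :
  subseq (rcons u a) (rcons v b) =
  if a == b then subseq u v else subseq (rcons u a) v.
Proof. 
rewrite -(subseq_rev (rcons u a) (rcons v b)) -(subseq_rev u v).
by rewrite -(subseq_rev (rcons u a) v) !rev_rcons /=; case: eqP. Qed.

Lemma subseq_rconsr (T : eqType) (u v : seq T) b :
  subseq u (rcons v b) ->
  subseq u v \/ exists2 u', u = rcons u' b & subseq u' v.
Proof.
case/lastP: u => [|u a]; first by left; exact: sub0seq.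
by rewrite subseq_rcons2; case: eqP => [-> ?|_ ?]; [right; exists u | left].
Qed.

Lemma letter_cost_lower sigma (w : seq nat) t p (a : nat) (u v : seq nat) :
  0 < sigma -> p <= size w ->
  a \in iota 1 sigma -> subseq u (take p w) -> size v = t ->
  {subset v <= iota 1 sigma} -> ~~ subseq (rcons v a) u ->
  letter_cost w (bound sigma w t) p a + size u <= p.
Proof.
move=> sigma_gt0; elim: p t a u v => [|p IH] t a u v lt_p a_s.
  by rewrite take0 subseq0 => /eqP ->.
(* Either the letter at position [p] is deleted, and the cost rises by at most one, or it is kept as
   the last letter of [u]. *)
rewrite (take_nth 0) // => /subseq_rconsr [sub_u|[u' -> sub_u]] sz_v sub_v.
  by move=> /(IH _ _ _ _ (ltnW lt_p) a_s sub_u sz_v sub_v) /=; case: ifP; lia.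
rewrite subseq_rcons2 size_rcons /= eq_sym; case: eqP => [eq_a|_] /=; last first.
  by move=> /(IH _ _ _ _ (ltnW lt_p) a_s sub_u sz_v sub_v); rewrite addnS ltnS.
(* The letter [a] is kept, so [v] itself must be missing from the rest. An empty [v] cannot be
   missing; otherwise its last letter [b] leads back to the previous round. *)
case/lastP: v sz_v sub_v => [|v b] sz_v sub_v; first by rewrite sub0seq.
case: t sz_v => [|t]; rewrite size_rcons => // -[sz_v] not_sub.
have b_s : b \in iota 1 sigma by apply: sub_v; rewrite mem_rcons mem_head.
have sub_v' : {subset v <= iota 1 sigma}.
  by move=> z z_v; apply: sub_v; rewrite mem_rcons inE z_v orbT.
have := IH _ _ _ _ (ltnW lt_p) b_s sub_u sz_v sub_v' not_sub.
have := letter_min_le (letter_cost w (bound sigma w t) p) b_s.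
have := letter_cost_bound w t p a sigma_gt0 => /=.
by case: ifP => [/eqP|]; lia.
Qed.

Lemma letter_cost_attained sigma (w : seq nat) t p (a : nat) : 0 < sigma -> p <= size w ->
  a \in iota 1 sigma ->
  exists u v : seq nat, [/\ subseq u (take p w), size v = t, {subset v <= iota 1 sigma},
    ~~ subseq (rcons v a) u & letter_cost w (bound sigma w t) p a + size u = p].
Proof.
move=> sigma_gt0; elim: p t a => [|p IH] t a lt_p a_s.
  exists [::], (nseq t a); split; rewrite ?take0 ?size_nseq ?subseq0 //.
    by move=> z; rewrite mem_nseq => /andP [_ /eqP ->].
  by rewrite -size_eq0 size_rcons.
have [u [v [sub_u sz_v sub_v not_sub eq_p]]] := IH t a (ltnW lt_p) a_s.
rewrite (take_nth 0) //=; case: eqP => [eq_a|ne_a] /=; last first.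
  exists (rcons u (nth 0 w p)), v; split=> //.
  - by rewrite subseq_rcons2 eqxx.
  - by rewrite subseq_rcons2 eq_sym; case: eqP.
  - by rewrite size_rcons; lia.
case: eqP => [eq_D|ne_D] /=; last first.
  exists u, v; split=> //; last by lia.
  exact: subseq_trans (subseq_rcons _ _).
(* The bound of round 0 is 0, so equality forces a positive round. There keeping [a] is optimal: a
   best solution of the previous round is extended by [a]. *)
case: t eq_D {u v sub_u sz_v sub_v not_sub eq_p} => // t [eq_D].
have [b b_s min_b] := letter_min_mem (letter_cost w (bound sigma w t) p) sigma_gt0.
have [u [v [sub_u sz_v sub_v not_sub eq_p]]] := IH t b (ltnW lt_p) b_s.
exists (rcons u (nth 0 w p)), (rcons v b); split.
- by rewrite subseq_rcons2 eqxx.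
- by rewrite size_rcons sz_v.
- by move=> z; rewrite mem_rcons inE => /predU1P [->|/sub_v].
- by rewrite subseq_rcons2 eq_a eqxx.
- by rewrite eq_D -min_b size_rcons addnS eq_p.
Qed.

Lemma min_deletions_bound sigma w k : 0 < sigma ->
  universal (iota 1 sigma) k w ->
  min_deletions (iota 1 sigma) w k (bound sigma w k.+1 (size w)).-1.
Proof.
move=> sigma_gt0 univ_w /=.
have [a a_s min_a] :=
  letter_min_mem (letter_cost w (bound sigma w k) (size w)) sigma_gt0.
have [u [v [sub_u sz_v sub_v not_sub eq_n]]] :=
  letter_cost_attained k sigma_gt0 (leqnn (size w)) a_s.
rewrite take_size in sub_u.
apply: (@min_deletionsI _ a _ _ _ u (rcons v a)) => //.
- rewrite -min_a; have := subseq_deletions sub_u.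
  by rewrite -{1}eq_n addnK.
- by rewrite size_rcons sz_v.
- by move=> z; rewrite mem_rcons inE => /predU1P [->|/sub_v].
move=> u'; case/lastP=> // v' b sub_u'; rewrite size_rcons => -[sz_v'] sub_v' not_sub'.
have b_s : b \in iota 1 sigma by apply: sub_v'; rewrite mem_rcons mem_head.
apply: leq_trans (letter_min_le _ b_s) _.
have {}sub_v' : {subset v' <= iota 1 sigma}.
  by move=> z z_v; apply: sub_v'; rewrite mem_rcons inE z_v orbT.
have sub_t : subseq u' (take (size w) w) by rewrite take_size.
have := letter_cost_lower sigma_gt0 (leqnn _) b_s sub_t sz_v' sub_v' not_sub'.
by move=> le_n; rewrite -(leq_add2r (size u')) subnK // size_subseq.
Qed.

(** * Maintaining the minimum by counting *)

Lemma upd_eq f i x : upd f i x i = x.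
Proof. by rewrite /upd eqxx. Qed.

Lemma upd_neq f i x j : j != i -> upd f i x j = f j.
Proof. by rewrite /upd => /negbTE ->. Qed.

(** An increment at [a] crosses the single threshold [f a], so one counting cell changes. *)
Lemma count_ltn_upd (s : seq nat) (f : nat -> nat) a d :
  uniq s -> a \in s ->
  count (fun x => d < upd f a (f a).+1 x) s =
  count (fun x => d < f x) s + (d == f a).
Proof.
have notin_s t : a \notin t ->
    count (fun x => d < upd f a (f a).+1 x) t = count (fun x => d < f x) t.
  move=> a_t; apply: eq_in_count => x x_t.
  by rewrite upd_neq //; apply: contraNneq a_t => <-.
elim: s => //= b s IH /andP [b_s uniq_s]; rewrite inE.
have [eq_ab _|ne_ab /= a_s] := eqVneq a b.
  rewrite -eq_ab in b_s *; rewrite notin_s // upd_eq ltnS leq_eqVlt.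
  by case: (ltngtP d (f a)) => _; lia.
by rewrite IH // upd_neq 1?eq_sym // addnA.
Qed.

(** The minimum moves only when, after the increment, every letter exceeds the old value [f a]; then
    [a] attains the new minimum. *)
Lemma letter_min_upd sigma f a : a \in iota 1 sigma ->
  letter_min sigma (upd f a (f a).+1) =
  if count (fun x => f a < f x) (iota 1 sigma) + 1 < sigma
  then letter_min sigma f else (f a).+1.
Proof.
move=> a_s; set g := upd f a _.
have le_fg x : f x <= g x by rewrite /g /upd; case: eqP => [->|].
have -> : count (fun x => f a < f x) (iota 1 sigma) + 1 =
    count (fun x => f a < g x) (iota 1 sigma).
  by rewrite count_ltn_upd ?iota_uniq ?eqxx.
have := all_count (fun x => f a < g x) (iota 1 sigma); rewrite size_iota.
have := count_size (fun x => f a < g x) (iota 1 sigma); rewrite size_iota.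
rewrite leq_eqVlt; case: eqP => [-> _|_ /= -> not_all].
  rewrite ltnn => /allP lt_g; apply: letter_min_unique => //.
  by exists a; rewrite // /g upd_eq.
have [b b_s] : exists2 b, b \in iota 1 sigma & ~~ (f a < g b).
  by apply/allPn; rewrite not_all.
rewrite -leqNgt => le_gb; apply: letter_min_unique; last first.
  by move=> x x_s; apply: leq_trans (le_fg x); exact: letter_min_le.
have ne_ba : b != a by apply: contraTneq le_gb => ->; rewrite /g upd_eq -ltnNge.
have sigma_gt0 : 0 < sigma by move: a_s; rewrite mem_iota; lia.
have [x x_s min_x] := letter_min_mem f sigma_gt0.
(* If [a] attained the old minimum, then [b], whose value is at most [f a], attains it too. *)
have [eq_xa|ne_xa] := eqVneq x a; last by exists x; rewrite // /g upd_neq.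
exists b => //; apply/eqP; rewrite eqn_leq -{1}min_x eq_xa le_gb.
exact: leq_trans (letter_min_le f b_s) (le_fg b).
Qed.

Lemma letter_cost_upd w D p a x :
  nth 0 w p = a -> (letter_cost w D p a).+1 != D p ->
  letter_cost w D p.+1 x =
  upd (letter_cost w D p) a (letter_cost w D p a).+1 x.
Proof.
move=> def_a ne_D; rewrite /= def_a /upd eq_sym.
by case: eqP => [->|//]; rewrite ne_D.
Qed.

Lemma letter_cost_same w D p a x :
  nth 0 w p = a -> (letter_cost w D p a).+1 = D p ->
  letter_cost w D p.+1 x = letter_cost w D p x.
Proof. by move=> def_a eq_D; rewrite /= def_a; case: eqP => // <-; rewrite eq_D eqxx. Qed.

Lemma eq_letter_min sigma f g : f =1 g -> letter_min sigma f = letter_min sigma g.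
Proof. by move=> eq_fg; rewrite /letter_min (eq_map eq_fg) eq_fg. Qed.

(** * Time-bounded execution on the word RAM *)

(** The time is only bounded, so that branches of different lengths share one budget. *)
Definition exec b P T c (Q : config -> Prop) : Prop :=
  exists2 t, t <= T & Q (iter t (step b P) c).

Lemma exec_done b P T c (Q : config -> Prop) : Q c -> exec b P T c Q.
Proof. by exists 0. Qed.

Lemma exec_step b P T c Q :
  exec b P T (step b P c) Q -> exec b P T.+1 c Q.
Proof. by case=> t le_t Qt; exists t.+1; rewrite ?iterSr. Qed.

Lemma exec_bind b P T1 T2 T c Q1 Q2 :
  exec b P T1 c Q1 -> (forall c', Q1 c' -> exec b P T2 c' Q2) ->
  T1 + T2 <= T -> exec b P T c Q2.
Proof.
move=> [t1 le1 /[swap] /[apply] -[t2 le2 Q2t]] le_T.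
exists (t2 + t1); last by rewrite iterD.
by apply: leq_trans le_T; rewrite addnC leq_add.
Qed.

Lemma exec_conseq b P T T' c (Q Q' : config -> Prop) :
  exec b P T c Q -> (forall c', Q c' -> Q' c') -> T <= T' -> exec b P T' c Q'.
Proof.
move=> [t le_t Qt] QQ' le_T.
by exists t; [exact: leq_trans le_T | exact: QQ'].
Qed.

Lemma bool_lt_word b (c : bool) : 0 < b -> c < 2 ^ b.
Proof.
move=> b_gt0; apply: leq_ltn_trans (leq_b1 c) _.
by rewrite -[1](expn0 2) ltn_exp2l.
Qed.

Section Steps.

Context (b : nat) (P : program) (T p : nat) (r m : nat -> nat) (Q : config -> Prop).

(** The last premise of each rule is the rest of the run, which allows symbolic execution; the
    word-size premises rule out wrap-around. *)
Lemma exec_const i x : nth Halt P p = Const i x -> x < 2 ^ b ->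
  exec b P T (Config p.+1 (upd r i x) m) Q -> exec b P T.+1 (Config p r m) Q.
Proof. by move=> get lt_x ex; apply: exec_step; rewrite /step /fetch get modn_small. Qed.

Lemma exec_op o i s t x y z : nth Halt P p = Op o i s t -> r s = x -> r t = y ->
  eval_op b o x y %% 2 ^ b = z ->
  exec b P T (Config p.+1 (upd r i z) m) Q -> exec b P T.+1 (Config p r m) Q.
Proof. by move=> get <- <- <- ex; apply: exec_step; rewrite /step /fetch get. Qed.

Lemma exec_add i s t x y : nth Halt P p = Op Add i s t -> r s = x -> r t = y ->
  x + y < 2 ^ b ->
  exec b P T (Config p.+1 (upd r i (x + y)) m) Q -> exec b P T.+1 (Config p r m) Q.
Proof.
move=> get eq_x eq_y lt_z; apply: exec_op get eq_x eq_y _.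
by rewrite modn_small.
Qed.

Lemma exec_sub i s t x y : nth Halt P p = Op Defs.Sub i s t -> r s = x -> r t = y ->
  y <= x -> x < 2 ^ b ->
  exec b P T (Config p.+1 (upd r i (x - y)) m) Q -> exec b P T.+1 (Config p r m) Q.
Proof.
move=> get eq_x eq_y le_yx lt_x; apply: exec_op get eq_x eq_y _.
have le_yb : y <= 2 ^ b by apply: leq_trans le_yx (ltnW lt_x).
(* The machine's value is [x - y] plus one full [2 ^ b]. *)
rewrite /= addnBA // addnC -addnBA // modnDl modn_small //.
by apply: leq_ltn_trans lt_x; exact: leq_subr.
Qed.

Lemma exec_eq i s t x y : nth Halt P p = Op Eq i s t -> r s = x -> r t = y ->
  0 < b ->
  exec b P T (Config p.+1 (upd r i (x == y)) m) Q -> exec b P T.+1 (Config p r m) Q.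
Proof.
move=> get eq_x eq_y b_gt0; apply: exec_op get eq_x eq_y _.
by rewrite modn_small // bool_lt_word.
Qed.

Lemma exec_lt i s t x y : nth Halt P p = Op Lt i s t -> r s = x -> r t = y ->
  0 < b ->
  exec b P T (Config p.+1 (upd r i (x < y)) m) Q -> exec b P T.+1 (Config p r m) Q.
Proof.
move=> get eq_x eq_y b_gt0; apply: exec_op get eq_x eq_y _.
by rewrite modn_small // bool_lt_word.
Qed.

Lemma exec_read i s x y : nth Halt P p = Read i s -> r s = x -> m x = y ->
  exec b P T (Config p.+1 (upd r i y) m) Q -> exec b P T.+1 (Config p r m) Q.
Proof. by move=> get <- <- ex; apply: exec_step; rewrite /step /fetch get. Qed.

Lemma exec_write i s x y : nth Halt P p = Write i s -> r i = x -> r s = y ->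
  exec b P T (Config p.+1 r (upd m x y)) Q -> exec b P T.+1 (Config p r m) Q.
Proof. by move=> get <- <- ex; apply: exec_step; rewrite /step /fetch get. Qed.

Lemma exec_jump l : nth Halt P p = Jump l ->
  exec b P T (Config l r m) Q -> exec b P T.+1 (Config p r m) Q.
Proof. by move=> get ex; apply: exec_step; rewrite /step /fetch get. Qed.

Lemma exec_jumpif i l (c : bool) : nth Halt P p = JumpIf i l -> r i = c ->
  exec b P T (Config (if c then l else p.+1) r m) Q ->
  exec b P T.+1 (Config p r m) Q.
Proof.
move=> get eq_c ex; apply: exec_step; rewrite /step /fetch get eq_c.
by case: c ex {eq_c}.
Qed.

End Steps.

(** * The program and its correctness *)

(* Memory: [w] at [3], the cells of [bound] at [3 + n], the counters
   [letter_cost] of the letters from [3 + 2n] on, and from [4 + 3n] on, in cell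
   [c], the number of letters whose counter exceeds [c]. When that number reaches
   [sigma], the minimal counter has just become [c + 1]; register 0 holds the
   minimal counter plus 1. Register 20 is never written, hence 0. *)
Definition del_prog : program := [::
  Const 1 1; Read 2 0; Read 3 1; Const 4 2; Read 4 4; Const 5 3;
  Op Add 6 5 2; Op Add 7 6 2; Op Add 8 7 2; Op Add 8 8 1; Op Add 9 8 2;
  (* 11: a round; 12: clear the counters *)
  Op Add 10 7 1;
  Op Eq 11 10 9; JumpIf 11 17; Write 10 20; Op Add 10 10 1; Jump 12;
  (* 17 *)
  Const 10 3; Const 0 1;
  (* 19: scan [w] *)
  Op Eq 11 10 6; JumpIf 11 40;
  Read 12 10; Op Add 12 12 7; Read 13 12; Op Add 14 10 2; Read 15 14;
  Write 14 0; Op Add 10 10 1; Op Add 16 13 1; Op Eq 11 16 15; JumpIf 11 19;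
  Write 12 16; Op Add 17 13 8; Read 18 17; Op Add 18 18 1; Write 17 18;
  Op Lt 11 18 3; JumpIf 11 19; Op Add 0 16 1; Jump 19;
  (* 40: next round, unless all [k + 1] are done *)
  Op Eq 11 4 20; JumpIf 11 44; Op Defs.Sub 4 4 1; Jump 11;
  (* 44 *)
  Op Defs.Sub 0 0 1; Halt].

(** The registers that stay fixed during a round; [j] counts the rounds still to come after it. *)
Record regs_ok n sigma j (r : nat -> nat) : Prop := RegsOk {
  reg1 : r 1 = 1; reg2 : r 2 = n; reg3 : r 3 = sigma; reg4 : r 4 = j;
  reg6 : r 6 = 3 + n; reg7 : r 7 = 3 + n + n; reg8 : r 8 = 3 + n + n + n + 1;
  reg9 : r 9 = 3 + n + n + n + 1 + n; reg20 : r 20 = 0 }.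

Ltac reg_lookup := rewrite /upd /=; first [eassumption | reflexivity].
Ltac lt_word := rewrite ?/upd /=; lia.
Ltac run_add := eapply exec_add; [reflexivity | reg_lookup | reg_lookup | lt_word | ].
Ltac run_eq := eapply exec_eq; [reflexivity | reg_lookup | reg_lookup | done | ].
Ltac run_lt := eapply exec_lt; [reflexivity | reg_lookup | reg_lookup | done | ].
Ltac run_sub :=
  eapply exec_sub; [reflexivity | reg_lookup | reg_lookup | lt_word | lt_word | ].
Ltac run_const := eapply exec_const; [reflexivity | lt_word | ].
Ltac run_read := eapply exec_read; [reflexivity | reg_lookup | | ].
Ltac run_write := eapply exec_write; [reflexivity | reg_lookup | reg_lookup | ].
Ltac run_jump := eapply exec_jump; [reflexivity | ].
Ltac run_jumpif := eapply exec_jumpif; [reflexivity | reg_lookup | ].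


Lemma del_prog_clear b n sigma j d i r m : 0 < b -> 4 * n + 4 < 2 ^ b ->
  regs_ok n sigma j r -> r 10 = i -> i + d = 3 + n + n + n + 1 + n ->
  exec b del_prog (5 * d + 2) (Config 12 r m) (fun c =>
    exists r' m', [/\ c = Config 17 r' m', regs_ok n sigma j r' &
      forall x, m' x = if i <= x < i + d then 0 else m x]).
Proof.
move=> b_gt0 lt_b; elim: d i r m => [|d IH] i r m [] * .
  run_eq; run_jumpif; rewrite ifT; last by lia.
  apply: exec_done; do 2 eexists; split; first by [].
    by split; reg_lookup.
  by move=> x; rewrite ifF //; lia.
rewrite mulnS; run_eq; run_jumpif; rewrite ifF; last by lia.
run_write; run_add; run_jump.
eapply exec_conseq; [apply: IH | move=> c [r' [m' [-> ok m'E]]] | ].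
- by split; reg_lookup.
- by reg_lookup.
- by lia.
- exists r', m'; split=> // x; rewrite m'E /upd.
  by case: (x =P i) => [->|ne]; repeat case: ifP; lia.
- by [].
Qed.

(** The state after [p] letters of a round. Bounds are overwritten in place, so the cells before [p]
    already belong to [t.+1]. *)
Record mem_ok (sigma : nat) (w : seq nat) (t p : nat) (m : nat -> nat) : Prop := MemOk {
  mem_w : forall i, i < size w -> m (3 + i) = nth 0 w i;
  mem_D : forall i, i < size w ->
    m (3 + i + size w) = bound sigma w (if i < p then t.+1 else t) i;
  mem_cnt : forall a : nat, a \in iota 1 sigma ->
    m (a + (3 + size w + size w)) = letter_cost w (bound sigma w t) p a;
  mem_h : forall c, c < size w ->
    m (c + (3 + size w + size w + size w + 1)) =
    count (fun a => c < letter_cost w (bound sigma w t) p a) (iota 1 sigma) }.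

(** The longest path through the loop body, instructions 19 to 39, takes 21 steps. *)
Lemma del_prog_letter b sigma (w : seq nat) j t p r m : 0 < b -> 4 * size w + 4 < 2 ^ b ->
  sigma <= size w -> p < size w -> nth 0 w p \in iota 1 sigma ->
  regs_ok (size w) sigma j r -> mem_ok sigma w t p m ->
  r 10 = 3 + p -> r 0 = bound sigma w t.+1 p ->
  exec b del_prog 21 (Config 19 r m) (fun c => exists r' m',
    [/\ c = Config 19 r' m', regs_ok (size w) sigma j r',
       mem_ok sigma w t p.+1 m', r' 10 = 3 + p.+1 &
       r' 0 = bound sigma w t.+1 p.+1]).
Proof.
move=> b_gt0 lt_b le_sn lt_pn a_s [] r1 r2 r3 r4 r6 r7 r8 r9 r20 [] mw mD mc mh r10 r0.
set n := size w in lt_b le_sn lt_pn r2 r6 r7 r8 r9 mw mD mc mh *.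
have a_le : 0 < nth 0 w p <= n by move: a_s; rewrite mem_iota; lia.
(* The cost is at most [p < n], so its counting cell lies inside the array. *)
have c_le := letter_cost_le w (bound sigma w t) p (nth 0 w p).
run_eq; run_jumpif; rewrite ifF; last by lia.
run_read; first exact: mw.
run_add; run_read; first exact: mc.
run_add; run_read; first exact: mD.
(* Cell [p] still holds the bound of round [t]; it is read just before being overwritten. *)
rewrite ltnn.
run_write; run_add; run_add; run_eq; run_jumpif.
set a := nth 0 w p in a_s a_le c_le *.
set c := letter_cost w (bound sigma w t) p a in c_le *.
have iota_le x : x \in iota 1 sigma -> 0 < x <= n by rewrite mem_iota; lia.
case: eqP => [eq_D|ne_D].
  have same x : letter_cost w (bound sigma w t) p.+1 x =
      letter_cost w (bound sigma w t) p x.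
    by apply: (@letter_cost_same _ _ _ a); rewrite // -addn1.
  apply: exec_done; do 2 eexists; split; first by [].
  - by split; reg_lookup.
  - split=> [i lt_i|i lt_i|x x_s|d lt_d].
    + by rewrite upd_neq ?mw //; lia.
    + rewrite /upd; case: eqP => [eq_i|ne_i]; last rewrite mD //.
        by have -> : i = p by [lia]; rewrite ltnS leqnn.
      by congr bound; repeat case: ifP; lia.
    + have := iota_le _ x_s; rewrite same => ?.
      by rewrite upd_neq ?mc //; lia.
    + rewrite upd_neq ?mh //; last by lia.
      by apply: eq_count => x; rewrite same.
  - by rewrite /upd /=; lia.
  - transitivity (bound sigma w t.+1 p); first by reg_lookup.
    congr _.+1.
    by apply: eq_letter_min => x; rewrite -same.
have updE x : letter_cost w (bound sigma w t) p.+1 x =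
    upd (letter_cost w (bound sigma w t) p) a c.+1 x.
  by apply: letter_cost_upd => //; apply/eqP; rewrite -addn1.
have hE d : count (fun x => d < letter_cost w (bound sigma w t) p.+1 x) (iota 1 sigma) =
    count (fun x => d < letter_cost w (bound sigma w t) p x) (iota 1 sigma) + (d == c).
  rewrite -(count_ltn_upd _ _ (iota_uniq _ _) a_s).
  by apply: eq_count => x; rewrite updE.
have minE : bound sigma w t.+1 p.+1 =
   if count (fun x => c < letter_cost w (bound sigma w t) p x) (iota 1 sigma) + 1 < sigma
   then bound sigma w t.+1 p else c.+2.
  rewrite [LHS]/= (eq_letter_min sigma updE) letter_min_upd //.
  by rewrite -/c; case: ifP.
set h := count _ _ in minE.
have h_le : h <= sigma by rewrite -[leqRHS](size_iota 1) count_size.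
run_write; run_add; run_read.
  by rewrite !upd_neq ?mh; [reflexivity | lia..].
rewrite -/h; run_add; run_write; run_lt; run_jumpif.
set m' := upd (upd (upd m _ _) _ _) _ _.
have mem_ok' : mem_ok sigma w t p.+1 m'.
  split=> [i lt_i|i lt_i|x x_s|d lt_d]; rewrite /m'.
  - by rewrite !upd_neq ?mw //; lia.
  - rewrite upd_neq; last by lia.
    rewrite upd_neq; last by lia.
    rewrite /upd; case: eqP => [eq_i|ne_i]; last rewrite mD //.
      by have -> : i = p by [lia]; rewrite ltnS leqnn.
    by congr bound; repeat case: ifP; lia.
  - have := iota_le _ x_s => ?; rewrite upd_neq; last by lia.
    rewrite updE /upd; case: (x =P a) => [->|ne_x]; first by rewrite eqxx addn1.
    by rewrite !ifF ?mc //; lia.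
  - rewrite hE /upd; case: (d =P c) => [->|ne_d]; first by rewrite eqxx.
    by rewrite !ifF ?mh ?addn0 //; lia.
(* Unless all [sigma] letters now exceed [c], register 0 stays; otherwise the minimum is [c.+1],
   stored as [c.+2]. *)
case: ltnP => [lt_h|ge_h]; last (run_add; run_jump).
  apply: exec_done; do 2 eexists; split; [by [] | by split; reg_lookup | by [] | | ].
    by rewrite /upd /=; lia.
  by rewrite minE lt_h; reg_lookup.
apply: exec_done; do 2 eexists; split; [by [] | by split; reg_lookup | by [] | | ].
  by rewrite /upd /=; lia.
by rewrite minE ltnNge ge_h /upd /= !addn1.
Qed.

Lemma del_prog_scan b sigma (w : seq nat) j t d p r m : 0 < b -> 4 * size w + 4 < 2 ^ b ->
  sigma <= size w -> {subset w <= iota 1 sigma} -> p + d = size w ->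
  regs_ok (size w) sigma j r -> mem_ok sigma w t p m ->
  r 10 = 3 + p -> r 0 = bound sigma w t.+1 p ->
  exec b del_prog (21 * d + 2) (Config 19 r m) (fun c => exists r' m',
    [/\ c = Config 40 r' m', regs_ok (size w) sigma j r',
       mem_ok sigma w t (size w) m' & r' 0 = bound sigma w t.+1 (size w)]).
Proof.
move=> b_gt0 lt_b le_sn sub_w; elim: d p r m => [|d IH] p r m eq_n regs mems r10 r0.
  move: regs eq_n mems r0 r10 => [r1 r2 r3 r4 r6 r7 r8 r9 r20]; rewrite addn0.
  move=> -> mems r0 r10.
  run_eq; run_jumpif; rewrite ifT; last by lia.
  apply: exec_done; do 2 eexists; split; [by [] | by split; reg_lookup | by [] | ].
  exact: r0.
have lt_p : p < size w by lia.
apply: (exec_bind (del_prog_letter b_gt0 lt_b le_sn lt_p _ regs mems r10 r0)).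
- exact/sub_w/mem_nth.
- move=> c [r' [m' [-> regs' mems' r10' r0']]].
  by apply: IH regs' mems' r10' r0'; lia.
- by lia.
Qed.

(** Clearing the two arrays of [n] cells takes [10 * n + 2] steps, the scan [21 * n + 2], and three
    more instructions set up the addresses and register 0. *)
Lemma del_prog_round b sigma (w : seq nat) j t r m : 0 < b -> 4 * size w + 4 < 2 ^ b ->
  0 < sigma <= size w -> {subset w <= iota 1 sigma} ->
  regs_ok (size w) sigma j r ->
  (forall i, i < size w -> m (3 + i) = nth 0 w i) ->
  (forall i, i < size w -> m (3 + i + size w) = bound sigma w t i) ->
  exec b del_prog (31 * size w + 7) (Config 11 r m) (fun c => exists r' m',
    [/\ c = Config 40 r' m', regs_ok (size w) sigma j r',
       mem_ok sigma w t (size w) m' & r' 0 = bound sigma w t.+1 (size w)]).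
Proof.
move=> b_gt0 lt_b /andP [sigma_gt0 le_sn] sub_w [] r1 r2 r3 r4 r6 r7 r8 r9 r20 mw mD.
set n := size w in lt_b le_sn r2 r6 r7 r8 r9 mw mD *.
apply: (@exec_conseq _ _ (31 * n + 6).+1); [ | by move=> c; apply | by lia].
run_add.
apply: (@exec_bind _ _ (5 * (2 * n) + 2) (21 * n + 2).+2); last by lia.
  apply: (@del_prog_clear _ n sigma j _ (3 + n + n + 1)) => //.
  by lia.
move=> c [r' [m' [-> [] ? ? ? ? ? ? ? ? ? m'E]]].
run_const; run_const.
apply: del_prog_scan => //; first exact: add0n.
split=> [i lt_i|i lt_i|a|d lt_d]; rewrite m'E.
  + by rewrite ifF ?mw //; lia.
  + by rewrite ifF ?mD //; lia.
  + by rewrite mem_iota => ?; rewrite ifT //; lia.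
  + by rewrite ifT ?count_pred0 //; lia.
(* On the empty prefix all costs are 0, so register 0 starts at 1. *)
rewrite upd_eq /=; congr _.+1; apply/esym/letter_min_unique => //.
  by exists 1; rewrite // mem_iota; lia.
Qed.

(** Only the input and the array of bounds carry over between rounds; at most 4 steps are added to
    each round. *)
Lemma del_prog_rounds b sigma (w : seq nat) j t r m : 0 < b -> 4 * size w + 4 < 2 ^ b ->
  0 < sigma <= size w -> j < 2 ^ b -> {subset w <= iota 1 sigma} ->
  regs_ok (size w) sigma j r ->
  (forall i, i < size w -> m (3 + i) = nth 0 w i) ->
  (forall i, i < size w -> m (3 + i + size w) = bound sigma w t i) ->
  exec b del_prog (j.+1 * (31 * size w + 11)) (Config 11 r m) (fun c =>
    halted del_prog c /\ reg c 0 = (bound sigma w (t + j).+1 (size w)).-1).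
Proof.
move=> b_gt0 lt_b ok_s /[swap] sub_w; have /andP [sigma_gt0 le_sn] := ok_s.
elim: j t r m => [|j IH] t r m lt_j regs mw mD.
  apply: (exec_bind (T2 := 4) (del_prog_round b_gt0 lt_b ok_s sub_w regs mw mD)); last by lia.
  move=> c [r' [m' [-> [] * ]]].
  have r0_le : bound sigma w t.+1 (size w) <= (size w).+1.
    apply: leq_trans (letter_cost_le w (bound sigma w t) (size w) 1).
    by apply: letter_min_le; rewrite mem_iota; lia.
  run_eq; eapply (exec_jumpif (c := true)); [reflexivity | by [] | ].
  eapply exec_sub; [reflexivity | reg_lookup | reg_lookup | by [] | by lia | ].
  apply: exec_done; split=> //.
  by rewrite addn0 /= subn1.
apply: (exec_bind (T2 := 4 + j.+1 * (31 * size w + 11))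
  (del_prog_round b_gt0 lt_b ok_s sub_w regs mw mD)); last by lia.
move=> c [r' [m' [-> [] r1 r2 r3 r4 r6 r7 r8 r9 r20 [] mw' mD' _ _ r0]]].
run_eq; eapply (exec_jumpif (c := false)); [reflexivity | by [] | ].
run_sub; run_jump.
have -> : t + j.+1 = t.+1 + j by rewrite addnS.
apply: IH => //.
- exact: ltnW.
- by split; rewrite ?upd_eq ?subn1 //; reg_lookup.
- by move=> i lt_i; rewrite mD' // lt_i.
Qed.

Theorem theorem4 :
  exists (P : program) (e C : nat),
  forall (w : seq nat) (n sigma k iw : nat),
    size w = n ->
    alph w =i iota 1 sigma ->
    1 < sigma ->
    sigma <= n ->
    universality_index (alph w) w iw ->
    k <= iw ->
    iw <= n %/ sigma ->
    exists m : nat,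
      min_deletions (iota 1 sigma) w k m /\
      computes_within (word_length e n) P [:: n, sigma, k & w]
        (C * (n * maxn 1 k)) m.
Proof.
(* Four extra bits make every address fit into a word. The factor 100 covers 11 initial steps and
   [k.+1] rounds, at most twice [maxn 1 k]. *)
exists del_prog, 4, 100 => w n sigma k iw sz_w alph_w sigma_gt1 le_sn.
move=> [univ_w _] le_k le_iw.
have sigma_gt0 : 0 < sigma by exact: ltnW.
have a_s : 1 \in iota 1 sigma by rewrite mem_iota; lia.
have sub_w : {subset w <= iota 1 sigma} by move=> a; rewrite -alph_w mem_undup.
have univ_k : universal (iota 1 sigma) k w.
  apply: (universal_leq a_s le_k) => v sz_v sub_v; apply: univ_w => // a /sub_v.
  by rewrite alph_w.
exists (bound sigma w k.+1 (size w)).-1; split; first exact: min_deletions_bound.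
have le_kn : k <= n.
  by apply: leq_trans le_k (leq_trans le_iw _); exact: leq_div.
set b := word_length 4 n.
have lt_b : 4 * n + 4 < 2 ^ b.
  have := trunc_log_ltn n (isT : 1 < 2); rewrite /b /word_length expnD; lia.
have b_gt0 : 0 < b by [].
suff [t le_t [halt_t out_t]] : exec b del_prog (100 * (n * maxn 1 k))
    (init [:: n, sigma, k & w]) (fun c =>
    halted del_prog c /\ reg c 0 = (bound sigma w k.+1 (size w)).-1).
  by exists t.
apply: (@exec_conseq _ _ (k.+1 * (31 * size w + 11)).+4.+4.+3); last 2 first.
- by move=> c; apply.
- by rewrite sz_w; nia.
rewrite /init; run_const.
run_read; first reflexivity.
run_read; first reflexivity.
run_const.
run_read; first reflexivity.
run_const; do 5 run_add.
apply: (@del_prog_rounds _ _ _ _ 0) => //; rewrite ?sz_w //.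
- by rewrite sigma_gt0.
- by lia.
(* The zero cells behind the input already encode the infinite bounds of round 0. *)
- by move=> i _; rewrite nth_default //= sz_w; lia.
Qed.
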